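(* Let $A \in \mathbb{R}^{m \times n}$, $B \in \mathbb{R}^{m \times p}$, $C \in \mathbb{R}^{s \times n}$, $D\in \mathbb{R}^{s \times p}$ and $M=\begin{pmatrix} A & B \\ C & D \end{pmatrix}$. Suppose that $R(B)\subseteq R(A)$, $R(C^T)\subseteq R(A^T)$, $R(C)\subseteq R(D)$ and $R(B^T)\subseteq R(D^T)$. Then $H^\dagger=J$, where $H=pppt(M,A)_{\dagger}$ and $J=cpppt(M,D)_{\dagger}$.
   Context: All matrices are real. $R(X)$ denotes the range (column space) of a matrix $X$ and $X^T$ its transpose. For $X\in\mathbb{R}^{m\times n}$, the Moore-Penrose inverse $X^\dagger\in\mathbb{R}^{n\times m}$ is the unique matrix $Y$ satisfying $X=XYX$, $Y=YXY$, $(XY)^T=XY$ and $(YX)^T=YX$. For a block matrix $M=\begin{pmatrix} A & B \\ C & D \end{pmatrix}$, the pseudo principal pivot transform of $M$ relative to $A$ is $$pppt(M,A)_{\dagger}=\begin{pmatrix} A^\dagger & -A^\dagger B\\ CA^\dagger & F\end{pmatrix},\qquad F=D-CA^\dagger B,$$ and the complementary pseudo principal pivot transform of $M$ relative to $D$ is $$cpppt(M,D)_{\dagger}=\begin{pmatrix} G & BD^\dagger\\ -D^\dagger C & D^\dagger\end{pmatrix},\qquad G=A-BD^\dagger C.$$ *)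

(* Defs.v *)
From mathcomp Require Import all_boot all_order all_algebra.
From mathcomp Require Import boolp classical_sets reals.

Set Implicit Arguments.
Unset Strict Implicit.
Unset Printing Implicit Defensive.
Import Order.TTheory GRing.Theory Num.Theory.
Local Open Scope ring_scope.
Local Open Scope classical_set_scope.

(* Column space, as opposed to the row space compared by [(_ <= _)%MS]. *)
Definition colrange (R : realType) (m n : nat) (X : 'M[R]_(m, n)) :
    set 'cV[R]_m :=
  range (fun v : 'cV[R]_n => X *m v).

Definition is_mpinv (R : realType) (m n : nat)
    (X : 'M[R]_(m, n)) (Y : 'M[R]_(n, m)) : bool :=
  [&& X == X *m Y *m X, Y == Y *m X *m Y,
      (X *m Y)^T == X *m Y & (Y *m X)^T == Y *m X].

Lemma row_free_gram_unit (R : realType) (m n : nat) (X : 'M[R]_(m, n)) :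
  row_free X -> X *m X^T \in unitmx.
Proof.
move=> fX; rewrite -row_free_unit; apply: inj_row_free => v vX0.
have /matrixP/(_ 0 0) : (v *m X) *m (v *m X)^T = 0.
  by rewrite trmx_mul -mulmxA (mulmxA X) mulmxA vX0 mul0mx.
rewrite mxE [RHS]mxE => /eqP; rewrite psumr_eq0; last first.
  by move=> i _; rewrite [_^T _ _]mxE -expr2 sqr_ge0.
move=> /allP vX; apply/eqP; rewrite -(mulmx_free_eq0 v fX).
apply/eqP/rowP => j; have := vX j (mem_index_enum j).
by rewrite [_^T _ _]mxE [RHS]mxE -expr2 sqrf_eq0 => /eqP.
Qed.

Lemma mpinv_exists (R : realType) (m n : nat) (X : 'M[R]_(m, n)) :
  exists Y, is_mpinv X Y.
Proof.
have uK := row_free_gram_unit (row_base_free X).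
have uL : (col_base X)^T *m col_base X \in unitmx.
  rewrite -{2}(trmxK (col_base X)); apply: row_free_gram_unit.
  by rewrite /row_free mxrank_tr; exact: col_base_full.
have := esym (mulmx_base X).
move: (\rank X) (col_base X) (row_base X) uL uK => r L K uL uK XE.
exists (K^T *m invmx (K *m K^T) *m invmx (L^T *m L) *m L^T).
set Y := (Y in is_mpinv _ Y).
have XY : X *m Y = L *m invmx (L^T *m L) *m L^T.
  by rewrite XE /Y !mulmxA -(mulmxA L K) -(mulmxA L (K *m _)) mulmxV // mulmx1.
have YX : Y *m X = K^T *m invmx (K *m K^T) *m K.
  by rewrite XE /Y -!mulmxA (mulmxA L^T L) (mulmxA (invmx _) (L^T *m L))
             mulVmx // mul1mx.
apply/and4P; split; apply/eqP.
- by rewrite XY XE -!mulmxA (mulmxA L^T L) (mulmxA (invmx _) (L^T *m L))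
             mulVmx // mul1mx.
- rewrite YX /Y !mulmxA -(mulmxA _ K) -(mulmxA _ (K *m _)) mulmxV //.
  by rewrite mulmx1.
- by rewrite XY !trmx_mul trmxK trmx_inv trmx_mul trmxK mulmxA.
- by rewrite YX !trmx_mul trmxK trmx_inv trmx_mul trmxK mulmxA.
Qed.

(* By [is_mpinv_unique] below, the choice made by [xchoose] is immaterial. *)
Definition mpinv (R : realType) (m n : nat) (X : 'M[R]_(m, n)) :
    'M[R]_(n, m) :=
  xchoose (mpinv_exists X).

Lemma mpinvP (R : realType) (m n : nat) (X : 'M[R]_(m, n)) :
  is_mpinv X (mpinv X).
Proof. exact: xchooseP. Qed.

Lemma is_mpinv_unique (R : realType) (m n : nat) (X : 'M[R]_(m, n))
    (Y Z : 'M[R]_(n, m)) :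
  is_mpinv X Y -> is_mpinv X Z -> Y = Z.
Proof.
move=> /and4P[/eqP XYX /eqP YXY /eqP sXY /eqP sYX].
move=> /and4P[/eqP XZX /eqP ZXZ /eqP sXZ /eqP sZX].
have XYZ : X *m Y = X *m Z.
  by rewrite -sXY {1}XZX -(mulmxA (X *m Z)) trmx_mul sXZ sXY mulmxA -XYX.
have YZX : Y *m X = Z *m X.
  by rewrite -sYX {1}XZX -(mulmxA X) mulmxA trmx_mul sZX sYX -mulmxA
             (mulmxA X) -XYX.
by rewrite YXY YZX -mulmxA XYZ mulmxA -ZXZ.
Qed.

(* The pivot blocks A and D of [pppt M] and [cpppt M] are read off the type
   'M_(m + s, n + p) of M. *)
Definition pppt (R : realType) (m s n p : nat)
    (M : 'M[R]_(m + s, n + p)) : 'M[R]_(n + s, m + p) :=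
  let A := ulsubmx M in let B := ursubmx M in
  let C := dlsubmx M in let D := drsubmx M in
  let F := D - C *m mpinv A *m B in
  block_mx (mpinv A) (- (mpinv A *m B)) (C *m mpinv A) F.

Definition cpppt (R : realType) (m s n p : nat)
    (M : 'M[R]_(m + s, n + p)) : 'M[R]_(m + p, n + s) :=
  let A := ulsubmx M in let B := ursubmx M in
  let C := dlsubmx M in let D := drsubmx M in
  let G := A - B *m mpinv D *m C in
  block_mx G (B *m mpinv D) (- (mpinv D *m C)) (mpinv D).

(* Main.v *)
Require Import Defs.
From mathcomp Require Import all_boot all_order all_algebra.
From mathcomp Require Import boolp classical_sets reals.
Import GRing.Theory.
Local Open Scope ring_scope.
Local Open Scope classical_set_scope.

(** A matrix has only one Moore-Penrose inverse, so it is enough that [J]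
    satisfies the four Penrose equations for [H].  Write [P] and [Q] for the
    Moore-Penrose inverses of [A] and [D].  The range inclusions say exactly
    that the projectors of [A] and [D] fix the off-diagonal blocks:
    [A P B = B], [C P A = C], [D Q C = C] and [B Q D = B].  When [H J] and
    [J H] are expanded, the terms containing both [P] and [Q] cancel in pairs,
    and these four identities cancel what is left off the diagonal.  Hence
    [H J = diag (P A, D Q)] and [J H = diag (A P, Q D)]: both products are
    block diagonal with orthogonal projectors as blocks, so they are symmetric,
    and these projectors fix [H] and [J] from the left. *)

(** If [Y] is an inner inverse of [A], then [A Y] is a projector onto the
    column space of [A], so it fixes every column of [B]. *)
Lemma colrange_sub_fixl {R : realType} {m n p : nat} {A : 'M[R]_(m, n)}
    {B : 'M[R]_(m, p)} {Y : 'M[R]_(n, m)} :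
  colrange B `<=` colrange A -> A *m Y *m A = A -> A *m Y *m B = B.
Proof.
move=> sBA AYA; apply/matrixP => i j.
have [|w _ wE] := sBA (col j B); first by exists (delta_mx j 0); rewrite -?colE.
have /matrixP/(_ i 0) : col j (A *m Y *m B) = col j B.
  by rewrite colE -mulmxA -colE -wE mulmxA AYA.
by rewrite !mxE.
Qed.

(** The row-space counterpart, obtained by transposition: the transpose of an
    inner inverse of [D] is an inner inverse of [D^T]. *)
Lemma colrange_tr_sub_fixr {R : realType} {m n p : nat} {D : 'M[R]_(m, n)}
    {B : 'M[R]_(p, n)} {Y : 'M[R]_(n, m)} :
  colrange B^T `<=` colrange D^T -> D *m Y *m D = D -> B *m Y *m D = B.
Proof.
move=> sBD DYD; apply: trmx_inj; rewrite !trmx_mul mulmxA.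
by apply: colrange_sub_fixl => //; rewrite -!trmx_mul mulmxA DYD.
Qed.

Theorem theorem1p1 (R : realType) (m n p s : nat)
    (A : 'M[R]_(m, n)) (B : 'M[R]_(m, p))
    (C : 'M[R]_(s, n)) (D : 'M[R]_(s, p))
    (hBA : colrange B `<=` colrange A)
    (hCA : colrange C^T `<=` colrange A^T)
    (hCD : colrange C `<=` colrange D)
    (hBD : colrange B^T `<=` colrange D^T) :
  let M := block_mx A B C D in
  let H := pppt M in
  let J := cpppt M in
  mpinv H = J.
Proof.
move=> M H J; apply: is_mpinv_unique (mpinvP H) _.
rewrite /H /J /pppt /cpppt /M block_mxKul block_mxKur block_mxKdl block_mxKdr.
have := mpinvP A; have := mpinvP D.
move: (mpinv A) (mpinv D) => P Q.
move=> /and4P[/eqP/esym DQD /eqP/esym QDQ /eqP sDQ /eqP sQD].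
move=> /and4P[/eqP/esym APA /eqP/esym PAP /eqP sAP /eqP sPA].
have APB := colrange_sub_fixl hBA APA.
have CPA := colrange_tr_sub_fixr hCA APA.
have DQC := colrange_sub_fixl hCD DQD.
have BQD := colrange_tr_sub_fixr hBD DQD.
set H' := block_mx P _ _ _; set J' := block_mx _ (B *m Q) _ _.
have HJ : H' *m J' = block_mx (P *m A) 0 0 (D *m Q).
  rewrite mulmx_block !(mulmxBl, mulmxBr, mulNmx, mulmxN, opprK, mulmxA).
  rewrite CPA DQC subrK subrr addrA addrAC subrK subrr.
  by rewrite addrCA subrr addr0.
have JH : J' *m H' = block_mx (A *m P) 0 0 (Q *m D).
  rewrite mulmx_block !(mulmxBl, mulmxBr, mulNmx, mulmxN, opprK, mulmxA).
  rewrite APB BQD subrK addrA addrAC addrK !addNr.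
  by rewrite addrCA subrr addr0.
rewrite /is_mpinv HJ JH !tr_block_mx !trmx0 sPA sDQ sAP sQD !eqxx !andbT.
rewrite !mulmx_block !mul0mx !addr0 !add0r.
by rewrite !(mulmxBr, mulmxN, mulmxA) PAP DQD DQC APA APB QDQ !eqxx.
Qed.
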